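(* Let $d,s\in\mathbb N$, let $A=(A_n)_{n\in\mathbb Z}\in \mathcal L^{\rm Lya}(\mathbb Z,\mathbb R^{d\times d})$ and $B=(B_n)_{n\in\mathbb Z}\in \mathcal L^{\infty}(\mathbb Z,\mathbb R^{d\times s})$, and suppose the discrete time-varying linear control system \[ x_{n+1}=A_nx_n+B_nu_n,\qquad n\in\mathbb Z, \] is uniformly completely controllable. Then the dichotomy spectrum of the closed-loop system is assignable: for every integer $\ell$ with $1\le \ell\le d$ and every family of pairwise disjoint closed intervals $[a_1,b_1],\dots,[a_\ell,b_\ell]\subset\mathbb R$ (with $a_i\le b_i$), there exists a bounded feedback $U=(U_n)_{n\in\mathbb Z}\in\mathcal L^{\infty}(\mathbb Z,\mathbb R^{s\times d})$ such that $A+BU:=(A_n+B_nU_n)_{n\in\mathbb Z}\in \mathcal L^{\rm Lya}(\mathbb Z,\mathbb R^{d\times d})$ and the dichotomy spectrum of the closed-loop system $x_{n+1}=(A_n+B_nU_n)x_n$ satisfies \[ \Sigma_{\rm ED}(A+BU)=\bigcup_{i=1}^{\ell}[a_i,b_i]. \]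
   Context: For a set $\mathbb T\in\{\mathbb Z,\mathbb Z_{\ge0},\mathbb Z_{\le0}\}$, $\mathcal L^{\infty}(\mathbb T,\mathbb R^{d\times s})$ denotes the set of sequences $M=(M_n)_{n\in\mathbb T}$ of $d\times s$ real matrices with $\sup_{n}\|M_n\|<\infty$, and $\mathcal L^{\rm Lya}(\mathbb T,\mathbb R^{d\times d})$ (Lyapunov sequences) denotes the set of $M\in\mathcal L^\infty(\mathbb T,\mathbb R^{d\times d})$ such that each $M_n$ is invertible and $(M_n^{-1})_{n}\in \mathcal L^\infty(\mathbb T,\mathbb R^{d\times d})$. For $M\in\mathcal L^{\rm Lya}(\mathbb Z,\mathbb R^{d\times d})$ the evolution operator of $x_{n+1}=M_nx_n$ is $\Phi_M(m,n)=M_{m-1}\cdots M_n$ for $m>n$, $\Phi_M(n,n)=\mathrm{id}$, and $\Phi_M(m,n)=M_m^{-1}\cdots M_{n-1}^{-1}$ for $m<n$. The system admits an exponential dichotomy (ED) on $\mathbb T$ if there are $K,\alpha>0$ and projections $(P_n)_{n\in\mathbb T}$ (invariant, i.e. $P_m\Phi_M(m,n)=\Phi_M(m,n)P_n$) with $\|\Phi_M(m,n)P_n\|\le Ke^{-\alpha(m-n)}$ for $m\ge n$ and $\|\Phi_M(m,n)(\mathrm{id}-P_n)\|\le Ke^{\alpha(m-n)}$ for $m\le n$, $m,n\in\mathbb T$. The dichotomy spectrum is $\Sigma_{\rm ED}(M)=\{\gamma\in\mathbb R: x_{n+1}=e^{-\gamma}M_nx_n \text{ has no ED on }\mathbb Z\}$.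 Uniform complete controllability: there exist $\alpha>0$ and $K\in\mathbb N$ such that for all $\xi\in\mathbb R^d$ and $k_0\in\mathbb Z$ there is a control sequence $u_{k_0},\dots,u_{k_0+K-1}$ such that the solution of $x_{n+1}=A_nx_n+B_nu_n$ with $x_{k_0}=0$ satisfies $x_{k_0+K}=\xi$, and $\|u_n\|\le\alpha\|\xi\|$ for $n=k_0,\dots,k_0+K-1$. *)

(* Defs.v *)
(* R : realType, matrices 'M[R]_(m,n) with the
   MathComp-Analysis max-entry norm (all norms are equivalent in finite
   dimension, so boundedness / exponential dichotomy do not depend on it). *)
From HB Require Import structures.
From mathcomp Require Import all_boot all_order all_algebra.
From mathcomp Require Import all_classical all_reals all_analysis.
Set Implicit Arguments. Unset Strict Implicit. Unset Printing Implicit Defensive.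
Import Order.TTheory GRing.Theory Num.Theory.
Import numFieldNormedType.Exports.
Local Open Scope classical_set_scope.
Local Open Scope ring_scope.

Definition bounded_seq (R : realType) (m n : nat) (M : int -> 'M[R]_(m, n)) :=
  exists C : R, forall k : int, `|M k| <= C.

Definition lyapunov_seq (R : realType) (d : nat) (M : int -> 'M[R]_d) :=
  [/\ bounded_seq M, (forall k, M k \in unitmx) & bounded_seq (fun k => invmx (M k))].

Fixpoint prodf (R : realType) (d : nat) (M : int -> 'M[R]_d) (n : int) (k : nat)
  : 'M[R]_d :=
  match k with
  | 0 => 1%:M
  | k'.+1 => M (n + k'%:Z) *m prodf M n k'
  end.

Fixpoint prodb (R : realType) (d : nat) (M : int -> 'M[R]_d) (n : int) (k : nat)
  : 'M[R]_d :=
  match k with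
  | 0 => 1%:M
  | k'.+1 => invmx (M (n - k'.+1%:Z)) *m prodb M n k'
  end.

Definition evol (R : realType) (d : nat) (M : int -> 'M[R]_d) (m n : int) : 'M[R]_d :=
  if (n <= m)%R then prodf M n `|m - n|%N else prodb M n `|n - m|%N.

Definition has_ED (R : realType) (d : nat) (M : int -> 'M[R]_d) :=
  exists (K alpha : R) (P : int -> 'M[R]_d),
    [/\ 0 < K /\ 0 < alpha,
        (forall n, P n *m P n = P n),
        (forall m n, P m *m evol M m n = evol M m n *m P n),
        (forall m n, (n <= m)%R ->
           `|evol M m n *m P n| <= K * expR (- alpha * (m - n)%:~R)) &
        (forall m n, (m <= n)%R ->
           `|evol M m n *m (1%:M - P n)| <= K * expR (alpha * (m - n)%:~R))].

Definition dichotomy_spectrum (R : realType) (d : nat) (M : int -> 'M[R]_d) : set R :=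
  [set gamma | ~ has_ED (fun n => expR (- gamma) *: M n)].

Fixpoint ctrl_traj (R : realType) (d s : nat) (A : int -> 'M[R]_d)
  (B : int -> 'M[R]_(d, s)) (u : int -> 'cV[R]_s) (k0 : int) (j : nat) : 'cV[R]_d :=
  match j with
  | 0 => 0
  | j'.+1 => A (k0 + j'%:Z) *m ctrl_traj A B u k0 j' + B (k0 + j'%:Z) *m u (k0 + j'%:Z)
  end.

Definition uniformly_completely_controllable (R : realType) (d s : nat)
  (A : int -> 'M[R]_d) (B : int -> 'M[R]_(d, s)) :=
  exists (alpha : R) (K : nat), 0 < alpha /\
    forall (xi : 'cV[R]_d) (k0 : int), exists u : int -> 'cV[R]_s,
      ctrl_traj A B u k0 K = xi /\
      forall j : nat, (j < K)%N -> `|u (k0 + j%:Z)| <= alpha * `|xi|.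

(* Main.v *)
(* Split time into windows of length 2K, K being the controllability horizon.
   Over a window two strategies steer the identity to a prescribed matrix D: move
   freely for K steps and then correct, or correct first so that the last K steps
   are free.  Every affine combination X^0 + t (X^1 - X^0) of the two matrix
   trajectories is again a trajectory ending at D, and each det (X^t_j) is a
   polynomial in t of degree at most d, bounded away from 0 at t = 0 (first half)
   or t = 1 (second half).  By Lagrange interpolation and the pigeonhole principle
   some t from a fixed finite set keeps all these determinants away from 0,
   uniformly over the windows, and u = W X^-1 is then a bounded feedback.

   Hence the closed loop is kinematically similar to any prescribed Lyapunov
   system.  The diagonal system with entries exp(b_i) for n >= 0 and exp(a_i) for
   n < 0 has dichotomy spectrum exactly the union of the [a_i, b_i]; surplus
   coordinates repeat the last interval. *)
Require Import Defs.
From HB Require Import structures.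
From mathcomp Require Import all_boot all_order all_algebra perm.
From mathcomp Require Import all_classical all_reals all_analysis.
From mathcomp Require Import zify ring lra.
Set Implicit Arguments. Unset Strict Implicit. Unset Printing Implicit Defensive.
Import Order.TTheory GRing.Theory Num.Theory.
Import numFieldNormedType.Exports.
Local Open Scope classical_set_scope.
Local Open Scope ring_scope.

(** * Interpolation and common points of nonvanishing *)

(** In the Lagrange formula the numerators are products of integers of size at most [M.+1], and the
    denominators are products of nonzero integers, hence at least 1 in absolute value. *)
Lemma horner_lagrange_bound (R : realType) (n M t : nat) (p : {poly R})
    (e : R) (s : seq nat) :
  uniq s -> size s = n.+1 -> {in s, forall x, (x <= M)%N} ->
  (size p <= n.+1)%N -> {in s, forall x, `|p.[x%:R]| <= e} -> (t <= M)%N ->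
  `|p.[t%:R]| <= n.+1%:R * M.+1%:R ^+ n.+1 * e.
Proof.
move=> us ss sM sp pe tM.
have sx (k : 'I_n.+1) : nth 0%N s k \in s by rewrite mem_nth ?ss.
have e0 : 0 <= e by apply: le_trans (pe _ (sx ord0)).
(* [lagrange_gen] takes an injective sequence of nodes, so the list is continued by integers beyond
   [M], which bounds all its elements. *)
pose g k := if (k < n.+1)%N then nth 0%N s k else (M.+1 + k)%N.
have g_inj : injective g.
  move=> i j; rewrite /g.
  case: ltnP => hi; case: ltnP => hj.
  - by move/eqP; rewrite nth_uniq ?ss // => /eqP.
  - by have := sM _ (sx (Ordinal hi)) => /=; lia.
  - by have := sM _ (sx (Ordinal hj)) => /=; lia.
  - by lia.
have x_inj : injective (fun k => (g k)%:R : R).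
  by move=> i j /eqP; rewrite eqr_nat => /eqP /g_inj.
have gE (k : 'I_n.+1) : g k = nth 0%N s k by rewrite /g ltn_ord.
rewrite (lagrange_gen (ltn0Sn n) x_inj sp) horner_sum.
apply: (le_trans (ler_norm_sum _ _ _)).
have -> : n.+1%:R * M.+1%:R ^+ n.+1 * e = \sum_(i < n.+1) M.+1%:R ^+ n.+1 * e.
  by rewrite sumr_const card_ord -mulrA mulr_natl.
apply: ler_sum => i _.
rewrite hornerM hornerC normrM mulrC.
apply: ler_pM => //; last by rewrite gE; apply/pe/sx.
rewrite (lagrangeE (ltn0Sn n) x_inj) hornerM hornerC normrM.
rewrite -[leRHS]mul1r; apply: ler_pM => //.
  rewrite normfV horner_prod invf_le1 ?normr_gt0; last first.
    apply/prodf_neq0 => j ji; rewrite hornerXsubC subr_eq0.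
    by rewrite (inj_eq x_inj) eq_sym.
  rewrite normr_prod; apply: (big_ind (fun x : R => 1 <= x)) => //.
    by move=> x y x1 y1; rewrite mulr_ege1.
  move=> j ji; rewrite hornerXsubC.
  have : g i != g j by rewrite (inj_eq g_inj) eq_sym.
  rewrite neq_ltn => /orP[gij|gij].
    by rewrite distrC -natrB 1?ltnW // normr_nat ler1n subn_gt0.
  by rewrite -natrB 1?ltnW // normr_nat ler1n subn_gt0.
have -> : M.+1%:R ^+ n.+1 = \prod_(j < n.+1) M.+1%:R :> R.
  by rewrite prodr_const card_ord.
(* The omitted index [j = i] becomes a factor 1, so the product runs over all [n.+1] indices. *)
rewrite horner_prod normr_prod big_mkcond /=; apply: ler_prod => j _; case: ifP => _; last first.
  by rewrite ler01 ler1n.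
rewrite normr_ge0 /= hornerXsubC gE.
have xM := sM _ (sx j).
case: (leqP t (nth 0%N s j)) => h.
  by rewrite distrC -natrB // normr_nat ler_nat; lia.
by rewrite -natrB 1?ltnW // normr_nat ler_nat; lia.
Qed.

(** If every candidate [t] were bad for some polynomial, one of the [m] polynomials would be small
    at more than [n] candidates, hence small at 0 and 1 by interpolation. *)
Lemma common_nonvanishing_point (R : realType) (m n : nat) (delta : R) :
  0 < delta -> exists (M : nat) (e : R), 0 < e /\
    forall p : 'I_m -> {poly R}, (forall j, (size (p j) <= n.+1)%N) ->
      (forall j, exists b : bool, delta <= `|(p j).[b%:R]|) ->
      exists2 t : nat, (t <= M)%N & forall j, e <= `|(p j).[t%:R]|.
Proof.
(* The candidates 0, ..., [M] number more than [m * n]; the successor also puts 1 among them when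
   [m * n] is 0. *)
move=> d0; pose M := (m * n).+1.
pose c : R := n.+1%:R * M.+1%:R ^+ n.+1.
have c0 : 0 < c by rewrite mulr_gt0 ?ltr0n // exprn_gt0 // ltr0n.
(* With this threshold the interpolation bound is [delta / 2], contradicting the lower bound
   [delta]. *)
exists M, (delta / (2 * c)); split; first by rewrite divr_gt0 // mulr_gt0.
move=> p sp pb; apply: contrapT => nt.
have bad (t : 'I_M.+1) : exists j, `|(p j).[t%:R]| < delta / (2 * c).
  apply: contrapT => nj; apply: nt; exists t; first by rewrite -ltnS.
  by move=> j; rewrite leNgt; apply/negP => h; apply: nj; exists j.
have [f fP] := choice bad.
have [j nj] : exists j, (n < #|[pred t | f t == j]|)%N.
  apply: contrapT => h.
  have : (\sum_(t < M.+1) 1 <= \sum_(j < m) n)%N.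
    rewrite (partition_big f xpredT) //=.
    apply: leq_sum => j _; rewrite leqNgt; apply/negP => hj; apply: h.
    exists j; rewrite -sum1_card; apply: leq_trans hj _.
    by rewrite eq_leq //; apply: eq_bigl => t; rewrite inE.
  rewrite sum1_card sum_nat_const !card_ord /M.
  lia.
have [b pjb] := pb j.
pose s := map val (take n.+1 (enum [pred t | f t == j])).
have : `|(p j).[b%:R]| <= c * (delta / (2 * c)).
  apply: (@horner_lagrange_bound _ n M b (p j) _ s) => //.
  - by rewrite map_inj_uniq ?take_uniq ?enum_uniq //; apply: val_inj.
  - by rewrite size_map size_takel // -cardE.
  - by move=> x /mapP[y _ ->]; exact: (ltn_ord y).
  - move=> x /mapP[y /mem_take]; rewrite mem_enum inE => /eqP <- ->.
    exact/ltW/fP.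
  - by case: (b); rewrite /M.
have -> : c * (delta / (2 * c)) = delta / 2 by field; rewrite gt_eqF.
by move/(le_trans pjb); lra.
Qed.

(** * Norm estimates, bounded and Lyapunov families *)

Lemma mx_entry_le_norm (R : realType) m n (A : 'M[R]_(m, n)) i j :
  `|A i j| <= `|A|.
Proof. by rewrite /Num.norm /= mx_normrE; apply: (le_bigmax _ _ (i, j)). Qed.

Lemma mx_norm_le (R : realType) m n (A : 'M[R]_(m, n)) (C : R) :
  0 <= C -> (forall i j, `|A i j| <= C) -> `|A| <= C.
Proof. by move=> C0 h; rewrite /Num.norm /= mx_normrE; apply: bigmax_le. Qed.

Lemma mx_norm_mul (R : realType) m n p (A : 'M[R]_(m, n)) (B : 'M[R]_(n, p)) :
  `|A *m B| <= n%:R * (`|A| * `|B|).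
Proof.
apply: mx_norm_le => [|i j]; first by rewrite !mulr_ge0.
rewrite mxE; apply: (le_trans (ler_norm_sum _ _ _)).
have -> : n%:R * (`|A| * `|B|) = \sum_(k < n) `|A| * `|B|.
  by rewrite sumr_const card_ord mulr_natl.
by apply: ler_sum => k _; rewrite normrM ler_pM ?mx_entry_le_norm.
Qed.

Lemma det_norm_le (R : realType) d (A : 'M[R]_d) (C : R) :
  `|A| <= C -> `|\det A| <= d`!%:R * C ^+ d.
Proof.
move=> AC; apply: (le_trans (ler_norm_sum _ _ _)).
have -> : d`!%:R * C ^+ d = \sum_(s : {perm 'I_d}) \prod_(i < d) C.
  by rewrite sumr_const prodr_const card_ord mulr_natl -[d`!]card_Sn.
apply: ler_sum => s _; rewrite normrM normr_sign mul1r normr_prod.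
by apply: ler_prod => i _; rewrite normr_ge0 (le_trans (mx_entry_le_norm _ _ _)).
Qed.

(** Take the minimum of the individual constants; including 1 covers [m = 0]. *)
Lemma pos_lower_bound_ord (R : realType) m (P : 'I_m -> R -> Prop) :
  (forall j e e', e' <= e -> P j e -> P j e') ->
  (forall j, exists e, 0 < e /\ P j e) -> exists2 e, 0 < e & forall j, P j e.
Proof.
move=> Pmono /choice[e eP].
exists (\big[Num.min/1]_j e j).
  by apply: lt_bigmin => // j _; have [] := eP j.
by move=> j; apply: Pmono (eP j).2; apply: bigmin_le.
Qed.

(* At [I := int] the next two notions are convertible to [bounded_seq] and
   [lyapunov_seq]. *)
Definition bounded_family (R : realType) (I : Type) m n (F : I -> 'M[R]_(m, n)) :=
  exists C : R, forall i, `|F i| <= C.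

Definition lyapunov_family (R : realType) (I : Type) d (F : I -> 'M[R]_d) :=
  [/\ bounded_family F, (forall i, F i \in unitmx)
    & bounded_family (fun i => invmx (F i))].

Lemma bounded_family_cst (R : realType) (I : Type) m n (A : 'M[R]_(m, n)) :
  bounded_family (fun _ : I => A).
Proof. by exists `|A|. Qed.

Lemma bounded_familyD (R : realType) (I : Type) m n (F G : I -> 'M[R]_(m, n)) :
  bounded_family F -> bounded_family G -> bounded_family (fun i => F i + G i).
Proof.
by move=> [C FC] [D GD]; exists (C + D) => i; rewrite (le_trans (ler_normD _ _)) ?lerD.
Qed.

Lemma bounded_familyN (R : realType) (I : Type) m n (F : I -> 'M[R]_(m, n)) :
  bounded_family F -> bounded_family (fun i => - F i).
Proof. by move=> [C FC]; exists C => i; rewrite normrN. Qed.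

Lemma bounded_familyB (R : realType) (I : Type) m n (F G : I -> 'M[R]_(m, n)) :
  bounded_family F -> bounded_family G -> bounded_family (fun i => F i - G i).
Proof. by move=> bF /bounded_familyN; apply: bounded_familyD. Qed.

Lemma bounded_familyM (R : realType) (I : Type) m n p
    (F : I -> 'M[R]_(m, n)) (G : I -> 'M[R]_(n, p)) :
  bounded_family F -> bounded_family G -> bounded_family (fun i => F i *m G i).
Proof.
move=> [C FC] [D GD]; exists (n%:R * (C * D)) => i.
by rewrite (le_trans (mx_norm_mul _ _)) // ler_wpM2l // ler_pM.
Qed.

Lemma bounded_familyZ (R : realType) (I : Type) m n (c : I -> R) (C : R)
    (F : I -> 'M[R]_(m, n)) :
  (forall i, `|c i| <= C) -> bounded_family F ->
  bounded_family (fun i => c i *: F i).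
Proof.
move=> cC [D FD]; exists (C * D) => i.
apply: mx_norm_le => [|a b]; first by rewrite mulr_ge0 // (le_trans _ (cC i), le_trans _ (FD i)).
by rewrite mxE normrM ler_pM // (le_trans (mx_entry_le_norm _ _ _)).
Qed.

(** Serves to splice window data into one sequence over time: [f] will be the position inside a
    window and [g] the start of that window. *)
Lemma bounded_family_finite (R : realType) (I J : Type) m n N
    (F : nat -> I -> 'M[R]_(m, n)) (f : J -> nat) (g : J -> I) :
  (forall k, (k <= N)%N -> bounded_family (F k)) -> (forall i, (f i <= N)%N) ->
  bounded_family (fun i => F (f i) (g i)).
Proof.
move=> bF fN.
have [C FC] : exists C : R, forall k, (k <= N)%N -> forall i, `|F k i| <= C.
  elim: N bF {fN} => [bF|N IH bF].
    by have [C FC] := bF 0%N isT; exists C => -[].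
  have [C FC] := IH (fun k hk => bF k (leqW hk)).
  have [D FD] := bF N.+1 (leqnn _).
  exists (Num.max C D) => k; rewrite leq_eqVlt => /orP[/eqP->|kN] i.
    by rewrite le_max FD orbT.
  by rewrite le_max FC.
by exists C => i; apply: FC.
Qed.

Lemma lyapunov_family_finite (R : realType) (I J : Type) d N
    (F : nat -> I -> 'M[R]_d) (f : J -> nat) (g : J -> I) :
  (forall k, (k <= N)%N -> lyapunov_family (F k)) -> (forall i, (f i <= N)%N) ->
  lyapunov_family (fun i => F (f i) (g i)).
Proof.
move=> lF fN; split.
- by apply: bounded_family_finite fN => k /lF[].
- by move=> i; have [_ + _] := lF _ (fN i); apply.
- apply: (bounded_family_finite (F := fun k i => invmx (F k i))) fN.
  by move=> k /lF[].
Qed.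

Lemma invmxM (R : comUnitRingType) n (A B : 'M[R]_n) :
  A \in unitmx -> B \in unitmx -> invmx (A *m B) = invmx B *m invmx A.
Proof.
move=> uA uB; have uAB : A *m B \in unitmx by rewrite unitmx_mul uA.
rewrite -[RHS]mul1mx -(mulVmx uAB) -mulmxA -(mulmxA A) (mulmxA B).
by rewrite mulmxV // mul1mx mulmxV // mulmx1.
Qed.

Lemma lyapunov_familyM (R : realType) (I : Type) d (F G : I -> 'M[R]_d) :
  lyapunov_family F -> lyapunov_family G ->
  lyapunov_family (fun i => F i *m G i).
Proof.
move=> [bF uF biF] [bG uG biG]; split; first exact: bounded_familyM.
  by move=> i; rewrite unitmx_mul uF uG.
under eq_fun do rewrite invmxM //.
exact: bounded_familyM.
Qed.

Lemma lyapunov_familyV (R : realType) (I : Type) d (F : I -> 'M[R]_d) :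
  lyapunov_family F -> lyapunov_family (fun i => invmx (F i)).
Proof.
move=> [bF uF biF]; split => //; first by move=> i; rewrite unitmx_inv.
by under eq_fun do rewrite invmxK.
Qed.

Lemma lyapunov_family_reindex (R : realType) (I J : Type) d (F : I -> 'M[R]_d)
    (g : J -> I) :
  lyapunov_family F -> lyapunov_family (F \o g).
Proof.
by move=> [[C FC] uF [D iFD]]; split; [exists C => i|move=> i|exists D => i];
  rewrite /= ?FC ?uF ?iFD.
Qed.

Lemma lyapunov_family1 (R : realType) (I : Type) d :
  lyapunov_family (fun _ : I => 1%:M : 'M[R]_d).
Proof.
split; [exact: bounded_family_cst|by move=> i; exact: unitmx1|].
exact: bounded_family_cst.
Qed.

(** The determinants of the inverses are bounded above, so those of the matrices are bounded
    below. *)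
Lemma lyapunov_family_det (R : realType) (I : Type) d (F : I -> 'M[R]_d) :
  lyapunov_family F -> exists2 e : R, 0 < e & forall i, e <= `|\det (F i)|.
Proof.
move=> [_ uF [C iFC]]; pose c := d`!%:R * (`|C| + 1) ^+ d.
have c0 : 0 < c.
  by rewrite mulr_gt0 ?ltr0n ?fact_gt0 ?exprn_gt0 // ltr_wpDl.
exists c^-1; first by rewrite invr_gt0.
move=> i; have := uF i; rewrite unitmxE unitfE => dF.
have : `|\det (invmx (F i))| <= c.
  apply: det_norm_le; rewrite (le_trans (iFC i)) // (le_trans (ler_norm _)) //.
  by rewrite lerDl.
rewrite det_inv normfV => h.
by rewrite -[leRHS]invrK lef_pV2 // posrE invr_gt0 normr_gt0.
Qed.

(** Converse direction, by the adjugate formula: cofactors are bounded because they are determinants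
    of bounded minors. *)
Lemma lyapunov_family_of_det (R : realType) (I : Type) d (F : I -> 'M[R]_d) (e : R) :
  bounded_family F -> 0 < e -> (forall i, e <= `|\det (F i)|) -> lyapunov_family F.
Proof.
move=> [C FC] e0 Fe.
have dF i : \det (F i) != 0 by rewrite -normr_gt0 (lt_le_trans e0).
have uF i : F i \in unitmx by rewrite unitmxE unitfE.
split => //; first by exists C.
(* The term [m = d.-1] bounds the cofactors and the other terms are nonnegative. *)
pose D := \sum_(m < d.+1) m`!%:R * `|C| ^+ m.
exists (e^-1 * D) => i.
have D0 : 0 <= D by apply: sumr_ge0 => m _; rewrite mulr_ge0 // exprn_ge0.
apply: mx_norm_le => [|a b]; first by rewrite mulr_ge0 // invr_ge0 ltW.
rewrite /invmx uF mxE normrM ler_pM //.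
  by rewrite normfV lef_pV2 // posrE normr_gt0.
rewrite mxE /cofactor normrM normrX normrN1 expr1n mul1r.
have hd : (d.-1 < d.+1)%N by rewrite ltnS leq_pred.
rewrite /D (bigD1 (Ordinal hd)) //= -[leLHS]addr0 lerD //; last first.
  by apply: sumr_ge0 => m _; rewrite mulr_ge0 // exprn_ge0.
apply: det_norm_le; apply: mx_norm_le => // a' b'.
by rewrite !mxE (le_trans (mx_entry_le_norm _ _ _)) // (le_trans (FC i)) // ler_norm.
Qed.

(** * Determinants along segments of matrices *)

(** In the Leibniz expansion each summand is, up to sign, a product of [d] entries affine in [t]. *)
Lemma size_det_pencil (R : realType) d (X Y : 'M[R]_d) :
  exists p : {poly R},
    (size p <= d.+1)%N /\ forall t, p.[t] = \det (X + t *: Y).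
Proof.
pose P := \matrix_(i, j) ((X i j)%:P + 'X * (Y i j)%:P) : 'M[{poly R}]_d.
exists (\det P); split=> [|t].
  apply: (leq_trans (size_sum _ _ _)); apply/bigmax_leqP => s _.
  rewrite mulr_sign (_ : size _ = size (\prod_i P i (s i))); last first.
    by case: (odd_perm s); rewrite ?size_polyN.
  apply: (leq_trans (size_poly_prod_leq _ _)).
  rewrite card_ord leq_subLR addnS ltnS.
  apply: (@leq_trans (\sum_(i < d) 2)); last first.
    by rewrite sum_nat_const card_ord; lia.
  apply: leq_sum => i _; rewrite mxE (leq_trans (size_polyD _ _)) // geq_max.
  rewrite (leq_trans (size_polyC_leq1 _)) //.
  by rewrite mulrC mul_polyC (leq_trans (size_scale_leq _ _)) // size_polyX.
rewrite -[LHS]/(horner_eval t (\det P)) -det_map_mx; congr (\det _).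
apply/matrixP => i j; rewrite !mxE.
by transitivity ((X i j)%:P + 'X * (Y i j)%:P).[t]; last by rewrite !hornerE.
Qed.

(* Each determinant is a polynomial in t of degree at most d that is bounded
   away from 0 at t = 0 or at t = 1, uniformly in the index i. *)
Lemma lyapunov_pencil (R : realType) (I : Type) m d
    (X Y : 'I_m -> I -> 'M[R]_d) :
  (forall j, bounded_family (X j)) -> (forall j, bounded_family (Y j)) ->
  (forall j, lyapunov_family (X j) \/ lyapunov_family (Y j)) ->
  exists (M : nat) (t : I -> nat), (forall i, (t i <= M)%N) /\
    forall j, lyapunov_family (fun i => X j i + (t i)%:R *: (Y j i - X j i)).
Proof.
move=> bX bY lXY.
have [e e0 eP] : exists2 e, 0 < e & forall j, exists b : bool, forall i,
    e <= `|\det (X j i + b%:R *: (Y j i - X j i))|.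
  apply: pos_lower_bound_ord => [j e e' ee [b h]|j].
    by exists b => i; apply: le_trans (h i).
  case: (lXY j) => /lyapunov_family_det[e e0 h]; exists e; split => //.
    by exists false => i; rewrite scale0r addr0.
  by exists true => i; rewrite scale1r addrC subrK.
have [M [e' [e'0 eP']]] := @common_nonvanishing_point R m d e e0.
have /choice[t tP] : forall i, exists t : nat, (t <= M)%N /\
    forall j, e' <= `|\det (X j i + t%:R *: (Y j i - X j i))|.
  move=> i.
  have [p pP] := choice (fun j => size_det_pencil (X j i) (Y j i - X j i)).
  have [j|j|t tM tP] := eP' p; first by have [] := pP j.
    by have [b h] := eP j; exists b; have [_ ->] := pP j.
  by exists t; split => // j; have [_ <-] := pP j.
exists M, t; split=> [i|j]; first by case: (tP i).
apply: (@lyapunov_family_of_det _ _ _ _ e') => //.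
  apply: bounded_familyD => //; apply: (@bounded_familyZ _ _ _ _ _ M%:R).
    by move=> i; rewrite normr_nat ler_nat; case: (tP i).
  exact: bounded_familyB.
by move=> i; case: (tP i).
Qed.

(** * Matrix trajectories and steering over a window *)

(** The [c] columns are simultaneous trajectories. The control is indexed by the time elapsed since
    [n0], whereas [ctrl_traj] uses absolute time. *)
Fixpoint mx_traj (R : realType) (d s c : nat) (A : int -> 'M[R]_d)
    (B : int -> 'M[R]_(d, s)) (n0 : int) (X0 : 'M[R]_(d, c))
    (W : nat -> 'M[R]_(s, c)) (j : nat) : 'M[R]_(d, c) :=
  if j is j'.+1 then
    A (n0 + j'%:Z) *m mx_traj A B n0 X0 W j' + B (n0 + j'%:Z) *m W j'
  else X0.

Lemma mx_traj_ext (R : realType) d s c A B n0 X0 (W W' : nat -> 'M[R]_(s, c)) j :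
  (forall i, (i < j)%N -> W i = W' i) ->
  @mx_traj R d s c A B n0 X0 W j = mx_traj A B n0 X0 W' j.
Proof.
elim: j => //= j IH h; rewrite IH ?h // => i ij.
by rewrite h // ltnW.
Qed.

Lemma mx_traj_free (R : realType) d s c A (B : int -> 'M[R]_(d, s)) n0 (X0 : 'M[R]_(d, c)) j :
  @mx_traj R d s c A B n0 X0 (fun=> 0) j = prodf A n0 j *m X0.
Proof.
by elim: j => [|j IH] /=; rewrite ?mul1mx // IH mulmx0 addr0 mulmxA.
Qed.

Lemma mx_trajD (R : realType) d s c A (B : int -> 'M[R]_(d, s)) n0 (X X' : 'M[R]_(d, c))
    (W W' : nat -> 'M[R]_(s, c)) j :
  mx_traj A B n0 (X + X') (fun i => W i + W' i) j =
  mx_traj A B n0 X W j + mx_traj A B n0 X' W' j :> 'M[R]_(d, c).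
Proof. by elim: j => //= j ->; rewrite !mulmxDr addrACA. Qed.

(** Turns a control steering 0 to the identity into one steering 0 to any given [E]. *)
Lemma mx_trajM (R : realType) d s c e A (B : int -> 'M[R]_(d, s)) n0 (X : 'M[R]_(d, c))
    (W : nat -> 'M[R]_(s, c)) (E : 'M[R]_(c, e)) j :
  mx_traj A B n0 (X *m E) (fun i => W i *m E) j =
  mx_traj A B n0 X W j *m E :> 'M[R]_(d, e).
Proof. by elim: j => //= j ->; rewrite !mulmxA mulmxDl. Qed.

Lemma mx_traj_shift (R : realType) d s c A (B : int -> 'M[R]_(d, s)) n0 (X : 'M[R]_(d, c))
    (W : nat -> 'M[R]_(s, c)) k j :
  mx_traj A B n0 X W (k + j) =
  mx_traj A B (n0 + k%:Z) (mx_traj A B n0 X W k) (fun i => W (k + i)%N) j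
  :> 'M[R]_(d, c).
Proof.
by elim: j => [|j IH]; rewrite ?addn0 // addnS /= IH -addrA -PoszD.
Qed.

Lemma mx_traj_segment (R : realType) d s c A (B : int -> 'M[R]_(d, s)) n0
    (X : 'M[R]_(d, c)) (W W' : nat -> 'M[R]_(s, c)) t j :
  mx_traj A B n0 X (fun i => W i + t *: (W' i - W i)) j =
  mx_traj A B n0 X W j + t *: (mx_traj A B n0 X W' j - mx_traj A B n0 X W j)
  :> 'M[R]_(d, c).
Proof.
elim: j => [|j IH] /=; first by rewrite subrr scaler0 addr0.
rewrite IH !mulmxDr -!scalemxAr !mulmxBr addrACA -scalerDr; congr (_ + _ *: _).
by rewrite addrACA opprD.
Qed.

Lemma mx_traj_bounded (R : realType) (I : Type) d s c A (B : int -> 'M[R]_(d, s))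
    (n0 : I -> int) (X : I -> 'M[R]_(d, c)) (W : nat -> I -> 'M[R]_(s, c)) j :
  bounded_seq A -> bounded_seq B -> bounded_family X ->
  (forall i, bounded_family (W i)) ->
  bounded_family (fun n => mx_traj A B (n0 n) (X n) (fun i => W i n) j).
Proof.
move=> [a Aa] [b Bb] bX bW; elim: j => //= j IH.
by apply: bounded_familyD; apply: bounded_familyM => //; [exists a|exists b] => n.
Qed.

Lemma prodf_lyapunov (R : realType) d (A : int -> 'M[R]_d) (k : int) j :
  lyapunov_seq A -> lyapunov_family (fun n0 => prodf A (n0 + k) j).
Proof.
move=> lA; elim: j => [|j IH] /=; first exact: lyapunov_family1.
apply: lyapunov_familyM => //.
exact: (lyapunov_family_reindex (fun n0 => n0 + k + j%:Z) lA).
Qed.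

(** Column [b] of the matrix control steers 0 to the basis vector [b]; basis vectors have norm at
    most 1, so [alpha] bounds all columns. *)
Lemma ucc_steering (R : realType) d s (A : int -> 'M[R]_d) (B : int -> 'M[R]_(d, s)) :
  uniformly_completely_controllable A B ->
  exists (K : nat) (G : nat -> int -> 'M[R]_(s, d)),
    (forall j, bounded_family (G j)) /\
    forall n0, mx_traj A B n0 0 (fun j => G j n0) K = 1%:M.
Proof.
move=> [alpha [K [alpha0 ucc]]]; exists K.
have /choice[u uP] (p : int * 'I_d) := ucc (delta_mx p.2 0) p.1.
(* From time [K] on controllability gives no bound on [u], so the control is set to 0 there. *)
exists (fun j n0 => if (j < K)%N then \matrix_(i, b) u (n0, b) (n0 + j%:Z) i 0 else 0).
split=> [j|n0].
  case: (ltnP j K) => jK; last exact: bounded_family_cst.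
  exists alpha => n0; apply: mx_norm_le => [|i b]; first exact: ltW.
  rewrite mxE (le_trans (mx_entry_le_norm _ _ _)) //.
  have [_ /(_ j jK) /le_trans] := uP (n0, b); apply.
  rewrite -[leRHS]mulr1 ler_pM2l //; apply: mx_norm_le => // i' j'.
  by rewrite mxE; case: (_ && _); rewrite ?normr1 ?normr0.
rewrite (@mx_traj_ext _ _ _ _ _ _ _ _ _
  (fun j => \matrix_(i, b) u (n0, b) (n0 + j%:Z) i 0)); last by move=> i ->.
apply/matrixP => i b; have [h _] := uP (n0, b).
have -> : (1%:M : 'M[R]_d) i b = (delta_mx b 0 : 'cV_d) i 0.
  by rewrite !mxE eqxx andbT.
rewrite -h /=; elim: K i {ucc uP h} => [|j IH] i /=; first by rewrite !mxE.
rewrite !mxE; congr (_ + _); apply: eq_bigr => k _; first by rewrite IH.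
by rewrite !mxE.
Qed.

(* A double window 2K: one strategy moves freely on the first half and corrects
   on the second, the other corrects first and then moves freely, so that at
   each instant one of the two trajectories is uniformly invertible. *)
Lemma window_assignment (R : realType) d s (A : int -> 'M[R]_d)
    (B : int -> 'M[R]_(d, s)) :
  (0 < d)%N -> lyapunov_seq A -> bounded_seq B ->
  uniformly_completely_controllable A B ->
  exists2 N : nat, (0 < N)%N & forall D : int -> 'M[R]_d, lyapunov_seq D ->
    exists W : nat -> int -> 'M[R]_(s, d),
      [/\ forall j, bounded_family (W j),
          forall j, (j <= N)%N ->
            lyapunov_family (fun n0 => mx_traj A B n0 1%:M (fun i => W i n0) j)
        & forall n0, mx_traj A B n0 1%:M (fun i => W i n0) N = D n0].
Proof.
move=> d0 lA bB /ucc_steering[K [G [bG GP]]].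
(* With [K = 0] the zero matrix would equal the identity. *)
have K0 : (0 < K)%N.
  case: K GP => // /(_ 0) /matrixP /(_ (Ordinal d0) (Ordinal d0)) /=.
  by rewrite !mxE eqxx => /esym/eqP; rewrite oner_eq0.
exists (K + K)%N; first by rewrite addn_gt0 K0.
move=> D lD; have [bA uA _] := lA.
pose Phi n0 := prodf A n0 K.
have lPhi k : lyapunov_family (fun n0 => Phi (n0 + k)) by exact: prodf_lyapunov.
have lPhi0 : lyapunov_family Phi.
  have -> : Phi = fun n0 => Phi (n0 + 0) by apply/funext => n0; rewrite addr0.
  exact: lPhi.
(* [F] is what the free motion misses at time [K + K]. [E] is the correction at time [K] after which
   the free motion ends at [D]. *)
pose F n0 := D n0 - Phi (n0 + K%:Z) *m Phi n0.
pose E n0 := invmx (Phi (n0 + K%:Z)) *m D n0 - Phi n0.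
have bF : bounded_family F.
  apply: bounded_familyB; first by case: lD.
  by apply: bounded_familyM; [case: (lPhi K%:Z)|case: lPhi0].
have bE : bounded_family E.
  apply: bounded_familyB; last by case: lPhi0.
  by apply: bounded_familyM; [case: (lPhi K%:Z)|case: lD].
pose W0 j n0 := if (j < K)%N then 0 else G (j - K)%N (n0 + K%:Z) *m F n0.
pose W1 j n0 := if (j < K)%N then G j n0 *m E n0 else 0.
have bGE k j : bounded_family (fun n0 => G j (n0 + k)).
  by have [C GC] := bG j; exists C => n.
have bW0 j : bounded_family (W0 j).
  rewrite /W0; case: ltnP => _; first exact: bounded_family_cst.
  exact: bounded_familyM.
have bW1 j : bounded_family (W1 j).
  rewrite /W1; case: ltnP => _; last exact: bounded_family_cst.
  exact: bounded_familyM.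
pose X W j n0 := mx_traj A B n0 (1%:M : 'M[R]_d) (fun i => W i n0) j.
have bX W j : (forall i, bounded_family (W i)) -> bounded_family (X W j).
  by move=> bW; apply: mx_traj_bounded => //; exact: bounded_family_cst.
have X0l j n0 : (j <= K)%N -> X W0 j n0 = prodf A n0 j.
  move=> jK; rewrite /X (@mx_traj_ext _ _ _ _ _ _ _ _ _ (fun=> 0)).
    by rewrite mx_traj_free mulmx1.
  by move=> i ij; rewrite /W0 (leq_trans ij jK).
have X1r j n0 : X W1 (K + j)%N n0 =
    prodf A (n0 + K%:Z) j *m (invmx (Phi (n0 + K%:Z)) *m D n0).
  rewrite /X mx_traj_shift (@mx_traj_ext _ _ _ _ _ _ _ _ _ (fun=> 0)); last first.
    by move=> i _; rewrite /W1 ltnNge leq_addr.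
  rewrite mx_traj_free; congr (_ *m _).
  (* Superposition: the free motion from the identity plus the steered motion from 0. *)
  rewrite (@mx_traj_ext _ _ _ _ _ _ _ _ _ (fun i => 0 + G i n0 *m E n0)); last first.
    by move=> i iK; rewrite /W1 iK add0r.
  rewrite -[1%:M]addr0 mx_trajD mx_traj_free mulmx1 -(mul0mx _ (E n0)).
  by rewrite mx_trajM GP mul1mx addrC subrK.
have X0N n0 : X W0 (K + K)%N n0 = D n0.
  rewrite /X mx_traj_shift -/(X W0 K n0) X0l // -/(Phi n0).
  rewrite (@mx_traj_ext _ _ _ _ _ _ _ _ _ (fun i => 0 + G i (n0 + K%:Z) *m F n0)).
    rewrite -[Phi n0]addr0 mx_trajD mx_traj_free -(mul0mx _ (F n0)).
    by rewrite mx_trajM GP mul1mx addrC subrK.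
  by move=> i iK; rewrite /W0 ltnNge leq_addr /= addKn add0r.
have X1N n0 : X W1 (K + K)%N n0 = D n0.
  by rewrite X1r -/(Phi _) mulmxA mulmxV ?mul1mx //; case: (lPhi K%:Z).
have l01 (j : 'I_(K + K).+1) : lyapunov_family (X W0 j) \/ lyapunov_family (X W1 j).
  case: (leqP j K) => jK; [left|right].
    have -> : X W0 j = fun n0 => prodf A (n0 + 0) j.
      by apply/funext => n0; rewrite addr0 X0l.
    exact: prodf_lyapunov.
  have -> : X W1 j = fun n0 => prodf A (n0 + K%:Z) (j - K) *m
      (invmx (Phi (n0 + K%:Z)) *m D n0).
    by apply/funext => n0; rewrite -X1r subnKC // ltnW.
  apply: lyapunov_familyM; first exact: prodf_lyapunov.
  by apply: lyapunov_familyM => //; exact: lyapunov_familyV.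
have [|j|M [t [tM tP]]] := lyapunov_pencil _ _ l01; try by move=> *; exact: bX.
pose W j n0 := W0 j n0 + (t n0)%:R *: (W1 j n0 - W0 j n0).
have XW j n0 : X W j n0 = X W0 j n0 + (t n0)%:R *: (X W1 j n0 - X W0 j n0).
  exact: mx_traj_segment.
exists W; split=> [j|j jN|n0].
- apply: bounded_familyD => //.
  apply: (@bounded_familyZ _ _ _ _ _ M%:R); last exact: bounded_familyB.
  by move=> n; rewrite normr_nat ler_nat.
- have := tP (Ordinal (jN : (j < (K + K).+1)%N)).
  by congr (lyapunov_family _); apply/funext => n0; rewrite /= -XW.
- by rewrite -[LHS]/(X W _ n0) XW X0N X1N subrr scaler0 addr0.
Qed.

(** * Kinematic similarity of the closed loop to a prescribed system *)

(** On each window the prescribed end matrix is the product of [Delta] over that window. The two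
    systems then agree over whole windows, and [T] compares them in between, being the identity at
    every window start. *)
Lemma closed_loop_similar (R : realType) d s (A : int -> 'M[R]_d)
    (B : int -> 'M[R]_(d, s)) (Delta : int -> 'M[R]_d) :
  (0 < d)%N -> lyapunov_seq A -> bounded_seq B ->
  uniformly_completely_controllable A B -> lyapunov_seq Delta ->
  exists (U : int -> 'M[R]_(s, d)) (T : int -> 'M[R]_d),
    [/\ bounded_seq U, lyapunov_seq T
      & forall n, (A n + B n *m U n) *m T n = T (n + 1) *m Delta n].
Proof.
move=> d0 lA bB ucc lD.
have [N N0 /(_ (fun n0 => prodf Delta n0 N))] := window_assignment d0 lA bB ucc.
have lP j : lyapunov_family (fun n0 => prodf Delta n0 j).
  by have := prodf_lyapunov 0 j lD; congr lyapunov_family; apply/funext => n; rewrite addr0.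
case=> [|W [bW lX XN]]; first exact: lP.
pose X j n0 := mx_traj A B n0 (1%:M : 'M[R]_d) (fun i => W i n0) j.
(* Time [n] is at position [r n] of the window of length [N] starting at [q n]. *)
pose r (n : int) := `|(n %% N)%Z|%N; pose q (n : int) := n - (r n)%:Z.
have rz n : (r n)%:Z = (n %% N)%Z by rewrite /r gez0_abs // modz_ge0 //; lia.
have rN n : (r n < N)%N by rewrite -ltz_nat rz ltz_pmod.
have rD n : r (n + 1) = `|((r n).+1%:Z %% N)%Z|%N.
  by rewrite {1}/r {1}(divz_eq n N) -(rz n) -addrA modzMDl intS [1 + _]addrC.
have rS n : ((r n).+1 < N)%N -> r (n + 1) = (r n).+1.
  by move=> h; rewrite rD modz_nat modn_small.
have rE n : (r n).+1 = N -> r (n + 1) = 0%N.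
  by move=> h; rewrite rD h modzz.
have qr n : q n + (r n)%:Z = n by rewrite /q subrK.
pose T n := X (r n) (q n) *m invmx (prodf Delta (q n) (r n)).
exists (fun n => W (r n) (q n) *m invmx (X (r n) (q n))), T.
have rN' n : (r n <= N)%N by exact: ltnW.
have lXr : lyapunov_family (fun n => X (r n) (q n)).
  exact: (lyapunov_family_finite (F := X)) rN'.
have lPr : lyapunov_family (fun n => prodf Delta (q n) (r n)).
  by apply: (lyapunov_family_finite (F := fun j n => prodf Delta n j)) rN' => j _.
split.
- apply: bounded_familyM; last by case: lXr.
  exact: (bounded_family_finite (F := W)) rN'.
- by apply: lyapunov_familyM => //; exact: lyapunov_familyV.
move=> n; have [_ uX _] := lXr; have [_ uP _] := lPr; have [_ uD _] := lD.
(* The feedback reproduces the open-loop control along [X], since it multiplies [X] by its own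
   inverse. *)
have step : (A n + B n *m (W (r n) (q n) *m invmx (X (r n) (q n)))) *m T n =
    X (r n).+1 (q n) *m invmx (prodf Delta (q n) (r n)).
  rewrite /T mulmxA; congr (_ *m _).
  by rewrite mulmxDl -!mulmxA mulVmx // mulmx1 /X /= qr.
rewrite step; case: (ltnP (r n).+1 N) => h.
  have qS : q (n + 1) = q n by rewrite /q rS //; lia.
  by rewrite /T rS // qS /= invmxM ?qr // -!mulmxA mulVmx // mulmx1.
(* At the end of a window [X] equals the product of [Delta], and [T] restarts at the identity. *)
have rN1 : (r n).+1 = N by apply/eqP; rewrite eqn_leq rN.
by rewrite /T rE // rN1 /X XN -rN1 /= qr invmx1 !mul1mx mulmxK.
Qed.

(** * Fundamental solutions and exponential diagonal matrices *)

(** Forward products and backward products of inverses both telescope; [M] inherits invertibility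
    from [V]. *)
Lemma evol_fundamental (R : realType) d (M V : int -> 'M[R]_d) (m n : int) :
  (forall k, V k \in unitmx) -> (forall k, V (k + 1) = M k *m V k) ->
  evol M m n = V m *m invmx (V n).
Proof.
move=> uV VM.
have ME k : M k = V (k + 1) *m invmx (V k) by rewrite VM mulmxK.
have uM k : M k \in unitmx by rewrite ME unitmx_mul unitmx_inv !uV.
have pf k : prodf M n k = V (n + k%:Z) *m invmx (V n).
  elim: k => [|k IH] /=; first by rewrite addr0 mulmxV.
  by rewrite IH mulmxA -VM; congr (V _ *m _); lia.
have pb k : prodb M n k = V (n - k%:Z) *m invmx (V n).
  elim: k => [|k IH] /=; first by rewrite subr0 mulmxV.
  rewrite IH mulmxA; congr (_ *m _).
  have -> : n - k%:Z = n - k.+1%:Z + 1 by lia.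
  by rewrite VM mulKmx.
rewrite /evol; case: ifP => mn; rewrite ?pf ?pb; congr (V _ *m _); lia.
Qed.

(** Parametrized by logarithms, so that products, inverses and the spectral shift become
    additive. *)
Definition exp_diag (R : realType) d (v : 'I_d -> R) : 'M[R]_d :=
  diag_mx (\row_i expR (v i)).

Lemma exp_diagD (R : realType) d (v w : 'I_d -> R) :
  exp_diag (fun i => v i + w i) = exp_diag v *m exp_diag w.
Proof.
by rewrite mulmx_diag; congr diag_mx; apply/rowP => i; rewrite !mxE expRD.
Qed.

Lemma exp_diag_unit (R : realType) d (v : 'I_d -> R) : exp_diag v \in unitmx.
Proof.
rewrite unitmxE det_diag unitfE; apply/prodf_neq0 => i _.
by rewrite mxE gt_eqF ?expR_gt0.
Qed.

Lemma exp_diagV (R : realType) d (v : 'I_d -> R) :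
  invmx (exp_diag v) = exp_diag (fun i => - v i).
Proof.
rewrite -[LHS]mulmx1 (_ : 1%:M = exp_diag v *m exp_diag (fun i => - v i)).
  by rewrite mulKmx ?exp_diag_unit.
rewrite -exp_diagD -diag_const_mx; congr diag_mx.
by apply/rowP => i; rewrite !mxE subrr expR0.
Qed.

Lemma exp_diagZ (R : realType) d (c : R) (v : 'I_d -> R) :
  expR c *: exp_diag v = exp_diag (fun i => c + v i).
Proof.
rewrite -[LHS]linearZ; congr diag_mx; apply/rowP => i.
by rewrite !mxE expRD.
Qed.

Lemma diag_mx_norm_le (R : realType) d (r : 'rV[R]_d) (C : R) :
  0 <= C -> (forall i, `|r 0 i| <= C) -> `|diag_mx r| <= C.
Proof.
move=> C0 rC; apply: mx_norm_le => // i j; rewrite mxE.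
by case: (i == j) => /=; rewrite ?mulr1n ?mulr0n ?normr0.
Qed.

Lemma exp_diag_bounded (R : realType) d (v : int -> 'I_d -> R) (C : R) :
  (forall n i, `|v n i| <= C) -> bounded_seq (fun n => exp_diag (v n)).
Proof.
move=> vC; exists (expR C) => n; apply: diag_mx_norm_le => [|i].
  exact: expR_ge0.
by rewrite mxE ger0_norm ?expR_ge0 // ler_expR (le_trans (ler_norm _)).
Qed.

Lemma exp_diag_lyapunov (R : realType) d (v : int -> 'I_d -> R) (C : R) :
  (forall n i, `|v n i| <= C) -> lyapunov_seq (fun n => exp_diag (v n)).
Proof.
move=> vC; split; [exact: exp_diag_bounded vC|by move=> n; exact: exp_diag_unit|].
have [C' hC'] : bounded_seq (fun n => exp_diag (fun i => - v n i)).
  by apply: (@exp_diag_bounded _ _ _ C) => n i; rewrite normrN.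
by exists C' => n; rewrite exp_diagV.
Qed.

(** * Scalar systems with different growth rates in the past and the future *)

(** Logarithm of the scalar solution equal to 1 at time 0 that grows at rate [b] from time 0 on and
    at rate [a] before. *)
Definition two_sided_exponent (R : realType) (a b : R) (n : int) : R :=
  (if 0 <= n then b else a) * n%:~R.

Lemma two_sided_exponentS (R : realType) (a b : R) (n : int) :
  two_sided_exponent a b (n + 1) =
  (if 0 <= n then b else a) + two_sided_exponent a b n.
Proof.
rewrite /two_sided_exponent rmorphD /= mulrDr mulr1 addrC.
case: (leP 0 n) => h; first by rewrite ifT //; lia.
case: (leP 0 (n + 1)) => // h'.
(* The rate changes only between -1 and 0, where the exponent vanishes at 0 under either rate. *)
have -> : n = -1 by lia.
by rewrite rmorphN /=; ring.
Qed.

(** The difference adds up [m - n] increments, each [a] or [b]. *)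
Lemma two_sided_exponent_le (R : realType) (a b e : R) (m n : int) :
  a <= e -> b <= e -> n <= m ->
  two_sided_exponent a b m - two_sided_exponent a b n <= e * (m - n)%:~R.
Proof.
move=> ae be nm; rewrite /two_sided_exponent rmorphB /=.
have nmR : n%:~R <= m%:~R :> R by rewrite ler_int.
case: (leP 0 m) => m0; case: (leP 0 n) => n0.
- by nra.
- have : 0 <= m%:~R :> R by rewrite ler0z.
  have : n%:~R <= 0 :> R by rewrite lerz0 ltW.
  by nra.
- by lia.
- by nra.
Qed.

Lemma two_sided_exponent_ge (R : realType) (a b e : R) (m n : int) :
  e <= a -> e <= b -> n <= m ->
  e * (m - n)%:~R <= two_sided_exponent a b m - two_sided_exponent a b n.
Proof.
move=> ae be nm.
have := @two_sided_exponent_le _ (- a) (- b) (- e) m n.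
rewrite !lerN2 => /(_ ae be nm).
have N k : two_sided_exponent (- a) (- b) k = - two_sided_exponent a b k.
  by rewrite /two_sided_exponent; case: ifP; rewrite mulNr.
by rewrite !N mulNr; lra.
Qed.

(** For nonzero [x], the inequality [1 + y <= expR y] makes [|x| * expR (e * k)] exceed [C] once [k]
    is beyond [C / (|x| * e)]. *)
Lemma exp_decay_eq0 (R : realType) (x C e : R) :
  0 < e -> (forall k : nat, `|x| <= C * expR (- e * k%:R)) -> x = 0.
Proof.
move=> e0 h; apply/eqP; rewrite -normr_le0 leNgt; apply/negP => x0.
have := archi_boundP (_ : 0 <= `|C / (`|x| * e)|).
set k := Num.bound _ => /(_ (normr_ge0 _)) hk.
have := h k; rewrite mulNr expRN ler_pdivlMr ?expR_gt0 // leNgt.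
move=> /negP; apply.
have xe : 0 < `|x| * e by rewrite mulr_gt0.
have : C < `|x| * (e * k%:R).
  rewrite mulrA mulrC -ltr_pdivrMr //; exact: le_lt_trans (ler_norm _) hk.
move/lt_le_trans; apply; rewrite ler_pM2l //.
by apply: le_trans (expR_ge1Dx _); rewrite lerDr.
Qed.

(** * Dichotomy criterion for systems similar to a diagonal one *)

Section DiagonalDichotomy.
Variables (R : realType) (d : nat) (a b : 'I_d -> R).
Variables (M T : int -> 'M[R]_d).
Hypothesis lT : lyapunov_seq T.
Hypothesis ME : forall m n, evol M m n =
  T m *m exp_diag (fun i => two_sided_exponent (a i) (b i) m -
                            two_sided_exponent (a i) (b i) n) *m invmx (T n).

(** In each coordinate both rates have the same strict sign. The projection keeps the coordinates
    with negative rates, and conjugation by [T] affects only the constant. *)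
Lemma has_ED_diagonal :
  (forall i, a i <= b i) -> (forall i, 0 < a i \/ b i < 0) -> has_ED M.
Proof.
move=> ab gap; have [[C TC] uT [C' T'C]] := lT.
have [e e0 eP] : exists2 e, 0 < e & forall i, (b i < 0 -> b i <= - e) /\
    (0 <= b i -> e <= a i).
  apply: pos_lower_bound_ord => [i e e' ee [h1 h2]|i].
    by split=> [/h1|/h2]; lra.
  have abi := ab i; case: (gap i) => h.
    by exists (a i); split=> //; split=> ?; lra.
  by exists (- b i); split; [lra|split=> ?; lra].
pose c i : R := (b i < 0)%R%:R.
pose P n := T n *m diag_mx (\row_i c i) *m invmx (T n).
have cc i : c i * c i = c i by rewrite /c; case: (_ < _); rewrite ?mulr1 ?mulr0.
have C0 : 0 <= C by apply: le_trans (TC 0).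
have C'0 : 0 <= C' by apply: le_trans (T'C 0).
(* Each of the two matrix products costs a factor [d]; the [+ 1] keeps the constant positive. *)
have bound m n (v : 'rV[R]_d) x : 0 <= x -> (forall i, `|v 0 i| <= x) ->
    `|T m *m diag_mx v *m invmx (T n)| <= (d%:R * (d%:R * (C * C')) + 1) * x.
  move=> x0 vx; rewrite (le_trans (mx_norm_mul _ _)) //.
  apply: (@le_trans _ _ (d%:R * (d%:R * (C * C')) * x)); last first.
    by rewrite ler_wpM2r // lerDl.
  have -> : d%:R * (d%:R * (C * C')) * x = d%:R * ((d%:R * (C * x)) * C') by ring.
  rewrite ler_wpM2l // ler_pM // (le_trans (mx_norm_mul _ _)) // ler_wpM2l //.
  by rewrite ler_pM // diag_mx_norm_le.
have conj m n (v w : 'rV[R]_d) k : T m *m diag_mx v *m invmx (T n) *m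
    (T n *m diag_mx w *m invmx (T k)) =
    T m *m diag_mx (\row_i (v 0 i * w 0 i)) *m invmx (T k).
  by rewrite -mulmx_diag !mulmxA mulmxKV.
have PE n : 1%:M - P n = T n *m diag_mx (\row_i (1 - c i)) *m invmx (T n).
  rewrite -{1}(mulmxV (uT n)) -mulmxBl -{1}[T n]mulmx1 -mulmxBr.
  congr (_ *m _ *m _); rewrite -diag_const_mx -linearB; congr diag_mx.
  by apply/rowP => i; rewrite !mxE.
exists (d%:R * (d%:R * (C * C')) + 1), e, P; split.
- by split=> //; rewrite ltr_wpDl // !mulr_ge0.
- move=> n; rewrite conj; congr (_ *m diag_mx _ *m _).
  by apply/rowP => i; rewrite !mxE.
- move=> m n; rewrite ME !conj; congr (_ *m diag_mx _ *m _).
  by apply/rowP => i; rewrite !mxE mulrC.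
- move=> m n nm; rewrite ME conj; apply: bound; first exact: expR_ge0.
  move=> i; rewrite !mxE /c; case: (ltP (b i) 0) => bi; last first.
    by rewrite mulr0 normr0 expR_ge0.
  rewrite mulr1 ger0_norm ?expR_ge0 // ler_expR.
  have [/(_ bi) h _] := eP i.
  by apply: two_sided_exponent_le => //; apply: le_trans (ab i) h.
- move=> m n mn; rewrite ME PE conj; apply: bound; first exact: expR_ge0.
  move=> i; rewrite !mxE /c; case: (ltP (b i) 0) => bi.
    by rewrite subrr mulr0 normr0 expR_ge0.
  rewrite subr0 mulr1 ger0_norm ?expR_ge0 // ler_expR.
  have [_ /(_ bi) h] := eP i.
  have := two_sided_exponent_ge h (le_trans h (ab i)) mn.
  by rewrite !rmorphB /=; lra.
Qed.

(* The i-th diagonal entry of the projection at time 0, in the coordinates T,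
   must vanish by forward decay and equal 1 by backward decay. *)
Lemma not_has_ED_diagonal (i : 'I_d) : a i <= 0 -> 0 <= b i -> ~ has_ED M.
Proof.
move=> ai bi [K [e [P [[K0 e0] _ _ fwd bwd]]]].
have [[C TC] uT [C' T'C]] := lT.
have C0 : 0 <= C by apply: le_trans (TC 0).
have C'0 : 0 <= C' by apply: le_trans (T'C 0).
pose Q := invmx (T 0) *m P 0 *m T 0.
pose E m := expR (two_sided_exponent (a i) (b i) m).
have entry m (Z : 'M[R]_d) x : `|evol M m 0 *m Z| <= x ->
    `|E m * (invmx (T 0) *m Z *m T 0) i i| <= d%:R * (d%:R * (C' * x) * C).
  move=> h.
  have -> : E m * (invmx (T 0) *m Z *m T 0) i i =
      (invmx (T m) *m (evol M m 0 *m Z) *m T 0) i i.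
    rewrite ME !mulmxA mulVmx // mul1mx -!mulmxA mul_diag_mx !mxE.
    by rewrite {2}/two_sided_exponent mulr0 subr0.
  rewrite (le_trans (mx_entry_le_norm _ _ _)) // (le_trans (mx_norm_mul _ _)) //.
  rewrite ler_wpM2l // ler_pM // (le_trans (mx_norm_mul _ _)) // ler_wpM2l //.
  by rewrite ler_pM.
have E1 (m : int) x y : 0 <= two_sided_exponent (a i) (b i) m ->
    `|E m * x| <= y -> `|x| <= y.
  move=> h; apply: le_trans; rewrite normrM -[leLHS]mul1r ler_wpM2r //.
  by rewrite ger0_norm ?expR_ge0 // -expR0 ler_expR.
pose L := d%:R * (d%:R * (C' * K) * C).
have Q0 : Q i i = 0.
  apply: (@exp_decay_eq0 _ _ L e) => // k.
  have /entry := fwd k%:Z 0 isT; rewrite subr0.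
  move/E1; have -> : L * expR (- e * k%:R) =
    d%:R * (d%:R * (C' * (K * expR (- e * k%:R))) * C) by rewrite /L; ring.
  by apply; rewrite /two_sided_exponent /= mulr_ge0.
have Q1 : 1 - Q i i = 0.
  apply: (@exp_decay_eq0 _ _ L e) => // k.
  have k0 : - k%:Z <= 0 by lia.
  have /entry := bwd (- k%:Z) 0 k0; rewrite subr0.
  have -> : (invmx (T 0) *m (1%:M - P 0) *m T 0) i i = 1 - Q i i.
    by rewrite mulmxBr mulmx1 mulmxBl mulVmx // !mxE eqxx.
  move/E1; have -> : L * expR (- e * k%:R) =
    d%:R * (d%:R * (C' * (K * expR (e * (- k%:Z)%:~R))) * C).
    by rewrite rmorphN /= mulrN mulNr /L; ring.
  apply; rewrite /two_sided_exponent rmorphN /=.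
  case: ifP => [h|_]; last by rewrite mulrN -mulNr mulr_ge0 // oppr_ge0.
  by have -> : k = 0%N by [lia]; rewrite oppr0 mulr0.
by move: Q1; rewrite Q0 subr0 => /eqP; rewrite oner_eq0.
Qed.

End DiagonalDichotomy.

(** * Assignment of the spectrum *)

Theorem theorem2p5 (R : realType) (d s : nat)
  (A : int -> 'M[R]_d) (B : int -> 'M[R]_(d, s)) :
  lyapunov_seq A -> bounded_seq B ->
  uniformly_completely_controllable A B ->
  forall (l : nat), (1 <= l <= d)%N ->
  forall a b : nat -> R,
    (forall i, (i < l)%N -> a i <= b i) ->
    (forall i j, (i < l)%N -> (j < l)%N -> i <> j ->
       `[a i, b i]%classic `&` `[a j, b j]%classic = set0) ->
    exists U : int -> 'M[R]_(s, d),
      [/\ bounded_seq U,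
          lyapunov_seq (fun n => A n + B n *m U n) &
          dichotomy_spectrum (fun n => A n + B n *m U n) =
            \bigcup_(i in [set i | (i < l)%N]) `[a i, b i]%classic].
Proof.
move=> lA bB ucc l /andP[l1 ld] a b ab _.
have d0 : (0 < d)%N by exact: leq_trans ld.
pose idx (i : 'I_d) := minn i l.-1.
have idxl i : (idx i < l)%N by rewrite /idx; lia.
pose rate (n : int) (i : 'I_d) := if 0 <= n then b (idx i) else a (idx i).
pose Delta n := exp_diag (rate n).
have lD : lyapunov_seq Delta.
  apply: (@exp_diag_lyapunov _ _ _
    (\sum_(i < d) (`|a (idx i)| + `|b (idx i)|))) => n i.
  rewrite (bigD1 i) //= ler_wpDr //; first by apply: sumr_ge0 => j _; rewrite addr_ge0.
  by rewrite /rate; case: ifP => _; rewrite ?lerDl ?lerDr.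
have [U [T [bU lT UT]]] := closed_loop_similar d0 lA bB ucc lD.
have [_ uT _] := lT.
have ME n : A n + B n *m U n = T (n + 1) *m Delta n *m invmx (T n).
  by rewrite -UT mulmxK.
exists U; split=> //.
  have -> : (fun n => A n + B n *m U n) =
      fun n => T (n + 1) *m Delta n *m invmx (T n) by apply/funext.
  apply: lyapunov_familyM; last exact: lyapunov_familyV.
  by apply: lyapunov_familyM => //; exact: (lyapunov_family_reindex (+%R^~ 1) lT).
have evolE gamma m n : evol (fun n => expR (- gamma) *: (A n + B n *m U n)) m n =
    T m *m exp_diag (fun i =>
      two_sided_exponent (a (idx i) - gamma) (b (idx i) - gamma) m -
      two_sided_exponent (a (idx i) - gamma) (b (idx i) - gamma) n) *m invmx (T n).
  (* Scaling by [expR (- gamma)] lowers every rate by [gamma], so [T n *m exp_diag (v n)] is a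
     fundamental solution. *)
  pose v n i := two_sided_exponent (a (idx i) - gamma) (b (idx i) - gamma) n.
  rewrite (@evol_fundamental _ _ _ (fun n => T n *m exp_diag (v n))).
  - rewrite invmxM ?exp_diag_unit // exp_diagV -!mulmxA; congr (_ *m _).
    by rewrite !mulmxA -exp_diagD.
  - by move=> k; rewrite unitmx_mul uT exp_diag_unit.
  move=> k; rewrite -scalemxAl ME -!mulmxA mulKmx // !scalemxAr; congr (_ *m _).
  rewrite exp_diagZ -exp_diagD; congr exp_diag.
  apply/funext => i; rewrite /v two_sided_exponentS /rate.
  by case: ifP => _; ring.
(* Outside the union, [gamma] lies strictly on one side of each interval, so all shifted rates are
   gapped. A point of interval [i] is handled by coordinate [i], which exists since [l <= d]. *)
apply/seteqP; split=> gamma /=.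
  move=> nED; apply: contrapT => h; apply: nED.
  apply: (has_ED_diagonal lT (evolE gamma)) => i; first by rewrite lerD2r ab.
  case: (ltP gamma (a (idx i))) => ha; first by left; rewrite subr_gt0.
  case: (ltP (b (idx i)) gamma) => hb; first by right; rewrite subr_lt0.
  by case: h; exists (idx i) => //=; rewrite in_itv /= ha hb.
case=> i /= il; rewrite in_itv /= => /andP[ai bi].
have id : (i < d)%N by exact: leq_trans ld.
have idxE : idx (Ordinal id) = i by rewrite /idx /=; lia.
apply: (not_has_ED_diagonal lT (evolE gamma) (i := Ordinal id));
  by rewrite idxE ?subr_le0 ?subr_ge0.
Qed.
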